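(* Let $G$ be a finite simple graph with at least one edge. If \[ \kappa_{\min}^{\mathrm{LLY}}(G)>\tfrac12, \] then \[ H^{\mathrm{GLMY}}_1(G;\mathbb R)=0 . \] Equivalently, if $H^{\mathrm{GLMY}}_1(G;\mathbb R)\neq 0$, then there exists an edge $\{x,y\}\in E(G)$ such that $\kappa_{\mathrm{LLY}}(x,y)\le \tfrac12$. The constant $\tfrac12$ is optimal, i.e. for no real number $c<\tfrac12$ is it true that every finite simple graph $G$ with at least one edge and $\kappa_{\min}^{\mathrm{LLY}}(G)>c$ satisfies $H^{\mathrm{GLMY}}_1(G;\mathbb R)=0$.
   Context: Graphs are undirected and simple; $x\sim y$ denotes adjacency, $d$ is the graph distance, $d_x$ is the degree of $x$. **Lin--Lu--Yau curvature.** Let $G=(V,E)$ be a connected locally finite graph. For a vertex $x$ of positive degree and $\alpha\in[0,1]$ let $\mu_x^\alpha$ be the probability measure on $V$ with $\mu_x^\alpha(x)=\alpha$, $\mu_x^\alpha(z)=(1-\alpha)/d_x$ for $z\sim x$, and $\mu_x^\alpha(z)=0$ otherwise. For finitely supported probability measures $\mu,\nu$ on $V$, $W_1(\mu,\nu)=\inf_\pi\sum_{u,v}d(u,v)\pi(u,v)$, the infimum being over all couplings $\pi:V\times V\to[0,\infty)$ of $\mu$ and $\nu$ (i.e. $\sum_v\pi(u,v)=\mu(u)$, $\sum_u\pi(u,v)=\nu(v)$). For distinct $x,y$ put $\kappa_\alpha(x,y)=1-W_1(\mu_x^\alpha,\mu_y^\alpha)/d(x,y)$ and \[ \kappa_{\mathrm{LLY}}(x,y)=\lim_{\alpha\to1^-}\frac{\kappa_\alpha(x,y)}{1-\alpha}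 \] (the limit is known to exist). If $G$ is not connected, the curvature of an edge is computed in the connected component containing it. For a finite graph with at least one edge, $\kappa_{\min}^{\mathrm{LLY}}(G)=\min_{\{x,y\}\in E(G)}\kappa_{\mathrm{LLY}}(x,y)$. **GLMY path homology.** Let $\mathbb F$ be a field and $V$ a finite set. An elementary $p$-path is a symbol $e_{i_0\ldots i_p}$ with $i_0,\dots,i_p\in V$; it is regular if $i_{q-1}\ne i_q$ for $1\le q\le p$. Let $\mathcal R_p(V;\mathbb F)$ be the $\mathbb F$-vector space spanned by elementary $p$-paths modulo those that are not regular (so it has the regular elementary $p$-paths as a basis), with boundary $\partial e_{i_0\ldots i_p}=\sum_{q=0}^p(-1)^q e_{i_0\ldots\widehat{i_q}\ldots i_p}$, nonregular terms being set to zero, and $\partial=0$ on $0$-paths. For a finite digraph $D=(V,E_D)$, a regular elementary path $e_{i_0\ldots i_p}$ is allowed if $(i_{q-1},i_q)\in E_D$ for $1\le q\le p$; $\mathcal A_p(D;\mathbb F)\subseteq\mathcal R_p(V;\mathbb F)$ is the span of the allowed elementary $p$-paths, and $\Omega_p(D;\mathbb F)=\{u\in\mathcal A_p(D;\mathbb F):\partial u\in\mathcal A_{p-1}(D;\mathbb F)\}$ (with $\Omega_0=\mathcal A_0$). Then $\partial\Omega_p\subseteq\Omega_{p-1}$, and $H^{\mathrm{GLMY}}_p(D;\mathbb F)=\ker(\partial|_{\Omega_p})/\partial(\Omega_{p+1})$. For an undirected finite graph $G$, $H^{\mathrm{GLMY}}_p(G;\mathbb F)$ is defined as $H^{\mathrm{GLMY}}_p$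 of the digraph obtained by replacing each edge $\{x,y\}$ by the two directed edges $(x,y)$ and $(y,x)$. *)

(* Defs.v *)
From HB Require Import structures.
From mathcomp Require Import all_boot all_order all_algebra.
From mathcomp Require Import all_classical all_reals all_analysis.
From mathcomp Require Import ring_quotient.
Set Implicit Arguments.
Unset Strict Implicit.
Unset Printing Implicit Defensive.
Import Order.TTheory GRing.Theory Num.Theory numFieldNormedType.Exports.
Local Open Scope classical_set_scope.
Local Open Scope ring_scope.

(* A finite simple graph is a symmetric irreflexive relation on a finType;
   these two properties are hypotheses of the theorems, not of the
   definitions. *)

Section Distance.
Variables (T : finType) (e : rel T).
Local Open Scope nat_scope.

Definition has_walk (n : nat) (u v : T) : bool :=
  [exists p : n.-tuple T, path e u p && (last u p == v)].

(* The range n < #|T| loses nothing, since a shortest walk repeats no vertex;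
   #|T| is a junk value for u and v in different components. *)
Definition gdist (u v : T) : nat :=
  \big[minn/#|T|]_(n < #|T| | has_walk n u v) n.

Lemma gdist_le n u v : has_walk n u v -> gdist u v <= n.
Proof.
move=> w; have [lt_n|le_n] := ltnP n #|T|.
  rewrite /gdist -minEnat -leEnat.
  exact: (@bigmin_le_cond _ _ _ _ (Ordinal lt_n)).
apply: leq_trans le_n; rewrite /gdist.
by elim/big_rec: _ => // i m _ le_m; rewrite geq_min le_m orbT.
Qed.

Lemma gdist_walk u v : connect e u v -> has_walk (gdist u v) u v.
Proof.
case/connectP=> p0 /shortenP[p e_p uniq_p _] ->.
have lt_p : size p < #|T|.
  by rewrite -[(size p).+1]/(size (u :: p)) -(card_uniqP uniq_p) max_card.
have w : has_walk (size p) u (last u p).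
  by apply/existsP; exists (in_tuple p); rewrite e_p eqxx.
have [eq_d|//] : gdist u (last u p) = #|T| \/
    has_walk (gdist u (last u p)) u (last u p).
  rewrite /gdist; elim/big_rec: _ => [|i m w_i IH]; first by left.
  by rewrite /minn; case: ifP => _; [right|].
by have := gdist_le w; rewrite eq_d leqNgt lt_p.
Qed.

End Distance.

Section LinLuYau.
Variables (R : realType) (T : finType) (e : rel T).

Definition degree (x : T) : nat := #|[set z | e x z]%SET|.

Definition component (x : T) : {set T} := [set z | connect e x z]%SET.

Definition lazy_walk (a : R) (x z : T) : R :=
  if z == x then a else if e x z then (1 - a) / (degree x)%:R else 0.

(* Couplings and transport cost on a vertex set C; only the values of mu, nu
   and pi on C are read. *)
Definition coupling (C : {set T}) (mu nu : T -> R) (pi : T -> T -> R) : Prop :=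
  [/\ forall u v, u \in C -> v \in C -> 0 <= pi u v,
      forall u, u \in C -> \sum_(v in C) pi u v = mu u
    & forall v, v \in C -> \sum_(u in C) pi u v = nu v].

Definition transport_cost (C : {set T}) (pi : T -> T -> R) : R :=
  \sum_(u in C) \sum_(v in C) (gdist e u v)%:R * pi u v.

Definition W1 (C : {set T}) (mu nu : T -> R) : R :=
  inf [set transport_cost C pi | pi in coupling C mu nu].

(* gdist e agrees on a component with the distance of that component. *)
Definition kappa (a : R) (x y : T) : R :=
  1 - W1 (component x) (lazy_walk a x) (lazy_walk a y) / (gdist e x y)%:R.

Definition kappa_LLY (x y : T) : R :=
  lim (kappa a x y / (1 - a) @[a --> (1 : R)^'-]).

(* An edge occurs once per orientation. The default of the iterated minimum is
   itself one of the values as soon as there is an edge. *)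
Definition kappa_min : R :=
  let s := [seq kappa_LLY p.1 p.2 | p in [pred p : T * T | e p.1 p.2]] in
  \big[Num.min/head 0 s]_(k <- s) k.

End LinLuYau.

Section GLMY.
Variables (F : fieldType) (T : finType).

Definition regular_path (p : nat) (t : p.+1.-tuple T) : bool :=
  sorted [rel a b | a != b] t.

Definition regpath (p : nat) := {t : p.+1.-tuple T | regular_path t}.

(* R_p, in coordinates on the basis of regular elementary p-paths. *)
Definition chain (p : nat) := {ffun regpath p -> F^o}.

(* The class of the elementary path t in R_p: zero when t is not regular. *)
Definition elem (p : nat) (t : p.+1.-tuple T) : chain p :=
  [ffun s => (val s == t)%:R].

Definition del (p : nat) (q : 'I_p.+2) (t : p.+2.-tuple T) : p.+1.-tuple T :=
  [tuple tnth t (lift q j) | j < p.+1].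

Definition boundary_fun (p : nat) (u : chain p.+1) : chain p :=
  \sum_(s : regpath p.+1)
     u s *: \sum_(q < p.+2) (-1) ^+ q *: elem (del q (val s)).

Fact boundary_is_linear p : linear (@boundary_fun p).
Proof.
move=> a u v; rewrite /boundary_fun scaler_sumr -big_split /=.
by apply: eq_bigr => s _; rewrite !ffunE scalerDl scalerA.
Qed.
HB.instance Definition _ p :=
  GRing.isLinear.Build F (chain p.+1) (chain p) _ (@boundary_fun p)
    (@boundary_is_linear p).

(* The boundary from R_(p+1) to R_p; the one on R_0 is zero and is accounted
   for in Omega and cycles. *)
Definition boundary (p : nat) : 'Hom(chain p.+1, chain p) :=
  linfun (@boundary_fun p).

Variable E : rel T.

Definition allowed (p : nat) : {vspace chain p} :=
  <<[seq elem (val s) | s in [pred s : regpath p | sorted E (val s)]]>>%VS.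

Definition Omega (p : nat) : {vspace chain p} :=
  match p return {vspace chain p} with
  | 0 => allowed 0
  | p'.+1 => (allowed p'.+1 :&: (boundary p' @^-1: allowed p'))%VS
  end.

Definition cycles (p : nat) : {vspace chain p} :=
  match p return {vspace chain p} with
  | 0 => Omega 0
  | p'.+1 => (Omega p'.+1 :&: lker (boundary p'))%VS
  end.

Definition boundaries (p : nat) : {vspace chain p} :=
  (boundary p @: Omega p.+1)%VS.

(* boundaries p seen inside the vector space of cycles. *)
Definition boundaries_in_cycles (p : nat) : {vspace subvs_of (cycles p)} :=
  (linfun (vsval : subvs_of (cycles p) -> chain p) @^-1: boundaries p)%VS.

Definition GLMY_homology (p : nat) : zmodType :=
  Quotient.quot (GRing.ZmodClosed.clone _ (pred_of_vspace (boundaries_in_cycles p)) _).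

End GLMY.

(* Main.v *)
From HB Require Import structures.
Require Import Defs.
From mathcomp Require Import all_boot all_order all_algebra.
From mathcomp Require Import all_classical all_reals all_analysis.
From mathcomp Require Import generic_quotient ring_quotient ring lra.
Set Implicit Arguments.
Unset Strict Implicit.
Unset Printing Implicit Defensive.
Import Order.TTheory GRing.Theory Num.Theory numFieldNormedType.Exports.
Local Open Scope ring_scope.

(** Vanishing is a maximum principle for harmonic 1-forms. If some 1-cycle is
    not a boundary, counting dimensions gives a nonzero cycle [z] orthogonal
    to all boundaries that are cycles (orthogonal_exists). Its coefficients
    form an antisymmetric function [w] on the arcs. Orthogonality to the
    boundaries of the 2-paths [aba], [abc] with [a] adjacent to [c], and
    [abc - adc] says that [w] has zero integral around triangles and
    quadrilaterals; that [z] is a cycle says that [w] has zero divergence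
    (harmonic_representative).

    Let [M = w x y] be the maximum of [w]. For [u] in the unit ball of [x] and
    [v] in that of [y], compare the route [u x y v] with a geodesic from [u] to
    [v]: the integral [D u v = M + w y v - w x u] of [w] along the route is 0
    if [u = v], equals [w u v <= M] if [u] and [v] are adjacent, since the route
    then closes up to a quadrilateral, and is at most [2 M] if [u = x] or
    [v = y] and the distance is 2. In all other cases it is at most [3 M]. Thus
    [D u v <= M * d(u, v)], except on the far moves, where [u != x], [v != y]
    and [d(u, v) = 2]; there the excess is at most [M].

    Transport the lazy walk at [x] to the lazy walk at [y]. As [w] has no
    divergence, the mean of [D] is [M], so
    [M <= M * (transport cost + mass of far moves)]. If the curvature exceeds
    1/2, some plan has cost below [1 - (1 - a) / 2]; such a plan has far mass
    less than [(1 - a) / 2] (coupling_far_move). So the factor of [M] on the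
    right is less than 1, and [M = 0] (harmonic_form_max_eq0).

    To read a plan off the curvature, the limit defining the latter must exist:
    [kappa_a / (1 - a)] is nondecreasing, because slowing the walks down mixes
    Dirac masses at [x] and [y] into a plan (coupling_slow_down), and it is
    bounded by 2.

    The pentagon shows that 1/2 is optimal. Its edges have curvature at least
    1/2, by an explicit plan at idleness 1/3. The form [winding] is additive
    along all 2-paths, so it kills boundaries, but its period around the
    pentagon is 5. *)

(** * Distances and transport plans *)

Section WalkDistance.
Variables (T : finType) (e : rel T).

Lemma has_walk_size (u : T) (p : seq T) : path e u p ->
  has_walk e (size p) u (last u p).
Proof. by move=> e_p; apply/existsP; exists (in_tuple p); rewrite e_p eqxx. Qed.

Lemma gdist_eq0 u v : connect e u v -> gdist e u v = 0%N -> u = v.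
Proof.
by move=> /gdist_walk + d0; rewrite d0 => /existsP[p]; rewrite tuple0 => /= /eqP.
Qed.

Lemma gdist_eq1 u v : connect e u v -> gdist e u v = 1%N -> e u v.
Proof.
move=> /gdist_walk + d1; rewrite d1 => /existsP[p].
by case/tupleP: p => w p; rewrite tuple0 /= andbT => /andP[+ /eqP <-].
Qed.

Lemma gdistxx u : gdist e u u = 0%N.
Proof. by apply/eqP; rewrite -leqn0; exact: gdist_le (@has_walk_size u [::] _). Qed.

Lemma gdist_edge u v : irreflexive e -> e u v -> gdist e u v = 1%N.
Proof.
move=> irr uv; apply/eqP; rewrite eqn_leq.
rewrite (gdist_le (@has_walk_size u [:: v] _)) /= ?uv// lt0n.
by apply/eqP => /(gdist_eq0 (connect1 uv)) eq_uv; rewrite eq_uv irr in uv.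
Qed.

End WalkDistance.

Section Couplings.
Variables (R : realType) (T : finType) (e : rel T) (C : {set T}).
Implicit Types (mu nu f : T -> R) (pi F G : T -> T -> R).

Lemma sum_dirac z f : z \in C -> \sum_(v in C) (v == z)%:R * f v = f z.
Proof.
move=> zC; rewrite (bigD1 z) //= eqxx mul1r big1 ?addr0 // => v /andP[_ /negPf->].
by rewrite mul0r.
Qed.

Lemma sum_dirac1 z : z \in C -> \sum_(v in C) (v == z)%:R = 1 :> R.
Proof.
move=> zC; rewrite -[RHS](sum_dirac (fun=> 1) zC).
by apply: eq_bigr => v _; rewrite mulr1.
Qed.

Definition plan_integral pi F : R :=
  \sum_(u in C) \sum_(v in C) pi u v * F u v.

Lemma transport_costE pi :
  transport_cost e C pi = plan_integral pi (fun u v => (gdist e u v)%:R).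
Proof. by apply: eq_bigr => u _; apply: eq_bigr => v _; rewrite mulrC. Qed.

Lemma plan_integralD pi F G :
  plan_integral pi (fun u v => F u v + G u v) =
  plan_integral pi F + plan_integral pi G.
Proof.
rewrite -big_split /=; apply: eq_bigr => u _; rewrite -big_split /=.
by apply: eq_bigr => v _; rewrite mulrDr.
Qed.

Lemma plan_integralZ pi a F :
  plan_integral pi (fun u v => a * F u v) = a * plan_integral pi F.
Proof.
rewrite /plan_integral mulr_sumr; apply: eq_bigr => u _; rewrite mulr_sumr.
by apply: eq_bigr => v _; rewrite mulrCA.
Qed.

Lemma plan_integralB pi F G :
  plan_integral pi (fun u v => F u v - G u v) =
  plan_integral pi F - plan_integral pi G.
Proof.
rewrite -mulN1r -plan_integralZ -plan_integralD.
by apply: eq_bigr => u _; apply: eq_bigr => v _; rewrite mulN1r.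
Qed.

Variables (mu nu : T -> R) (pi : T -> T -> R).
Hypothesis cpl : coupling C mu nu pi.

Lemma plan_integral_fst f :
  plan_integral pi (fun u _ => f u) = \sum_(u in C) mu u * f u.
Proof.
by case: cpl => _ pi1 _; apply: eq_bigr => u Cu; rewrite -mulr_suml pi1.
Qed.

Lemma plan_integral_snd f :
  plan_integral pi (fun _ v => f v) = \sum_(v in C) nu v * f v.
Proof.
case: cpl => _ _ pi2; rewrite /plan_integral exchange_big /=.
by apply: eq_bigr => v Cv; rewrite -mulr_suml pi2.
Qed.

(** A plan charges no pair off the supports of its marginals, so integrands
    need only be compared there. *)
Lemma le_plan_integral F G :
    (forall u v, u \in C -> v \in C -> mu u != 0 -> nu v != 0 ->
       F u v <= G u v) ->
  plan_integral pi F <= plan_integral pi G.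
Proof.
case: cpl => pi0 pi1 pi2 leFG.
apply: ler_sum => u Cu; apply: ler_sum => v Cv.
have [->|piN0] := eqVneq (pi u v) 0; first by rewrite !mul0r.
have pi_gt0 : 0 < pi u v by rewrite lt_def piN0 pi0.
rewrite ler_pM2l //; apply: leFG => //; rewrite gt_eqF //.
  rewrite -pi1 // (bigD1 v) //=; apply: ltr_wpDr => //.
  by apply: sumr_ge0 => w /andP[Cw _]; exact: pi0.
rewrite -pi2 // (bigD1 u) //=; apply: ltr_wpDr => //.
by apply: sumr_ge0 => w /andP[Cw _]; exact: pi0.
Qed.

Lemma transport_cost_ge0 : 0 <= transport_cost e C pi.
Proof.
by case: cpl => pi0 _ _; do 2![apply: sumr_ge0 => ? ?]; rewrite mulr_ge0 ?pi0.
Qed.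

End Couplings.

Section Wasserstein.
Variables (R : realType) (T : finType) (e : rel T) (C : {set T}).
Implicit Types (mu nu : T -> R) (pi : T -> T -> R).

Lemma W1_le_cost mu nu pi :
  coupling C mu nu pi -> W1 e C mu nu <= transport_cost e C pi.
Proof.
move=> cpl; apply: ge_inf; last by exists pi.
by exists 0 => _ [pi' cpl' <-]; exact: transport_cost_ge0 cpl'.
Qed.

Lemma coupling_product mu nu :
    (forall u, 0 <= mu u) -> (forall v, 0 <= nu v) ->
    \sum_(u in C) mu u = 1 -> \sum_(v in C) nu v = 1 ->
  coupling C mu nu (fun u v => mu u * nu v).
Proof.
move=> mu0 nu0 mu1 nu1; split=> [u v _ _|u _|v _]; first exact: mulr_ge0.
  by rewrite -mulr_sumr nu1 mulr1.
by rewrite -mulr_suml mu1 mul1r.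
Qed.

End Wasserstein.

(** * Lazy walks and the curvature of an edge *)

Section LazyWalk.
Variables (R : realType) (T : finType) (e : rel T).
Hypothesis irr_e : irreflexive e.
Variable x : T.

Lemma degree_gt0 y : e x y -> (0 < degree e x)%N.
Proof. by move=> xy; apply/card_gt0P; exists y; rewrite inE. Qed.

Lemma lazy_walkxx (a : R) : lazy_walk e a x x = a.
Proof. by rewrite /lazy_walk eqxx. Qed.

Lemma lazy_walk_edge (a : R) z :
  e x z -> lazy_walk e a x z = (1 - a) / (degree e x)%:R.
Proof.
rewrite /lazy_walk => xz; rewrite xz; case: eqP => // zx.
by rewrite zx irr_e in xz.
Qed.

Lemma lazy_walk_support (a : R) z :
  lazy_walk e a x z != 0 -> z = x \/ e x z.
Proof.
by rewrite /lazy_walk; case: (z =P x) => [->|_]; [left|case: ifP; [right|rewrite eqxx]].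
Qed.

Lemma lazy_walk_ge0 (a : R) z : 0 <= a <= 1 -> 0 <= lazy_walk e a x z.
Proof.
case/andP=> a0 a1; rewrite /lazy_walk.
by do 2![case: ifP => // _]; rewrite divr_ge0 ?subr_ge0.
Qed.

Lemma lazy_walk_mix (a b t : R) z : b = (1 - t) * a + t ->
  lazy_walk e b x z = (1 - t) * lazy_walk e a x z + t * (z == x)%:R.
Proof.
move=> ->; rewrite /lazy_walk; case: (z == x); first by rewrite mulr1.
case: ifP => _; last by rewrite !mulr0 addr0.
by rewrite mulr0 addr0 mulrA; congr (_ / _); ring.
Qed.

Lemma sum_lazy_walk (a : R) (C : {set T}) (f : T -> R) :
    x \in C -> (forall z, e x z -> z \in C) ->
  \sum_(z in C) lazy_walk e a x z * f z =
  a * f x + (1 - a) / (degree e x)%:R * \sum_(z | e x z) f z.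
Proof.
move=> Cx CN; rewrite (bigD1 x) //= lazy_walkxx; congr (_ + _).
rewrite (bigID (e x)) /= [X in _ + X]big1 ?addr0; last first.
  move=> z /andP[/andP[_ /negPf zx] /negPf xz].
  by rewrite /lazy_walk zx xz mul0r.
rewrite mulr_sumr; apply: eq_big => [z|z /andP[_ xz]].
  apply/idP/idP => [/andP[]//|xz]; rewrite xz CN // andbT /=.
  by apply/eqP => zx; rewrite zx irr_e in xz.
by rewrite lazy_walk_edge.
Qed.

Lemma lazy_walk_total (a : R) (C : {set T}) y :
    e x y -> x \in C -> (forall z, e x z -> z \in C) ->
  \sum_(z in C) lazy_walk e a x z = 1.
Proof.
move=> xy Cx CN; have := @sum_lazy_walk a C (fun=> 1) Cx CN.
rewrite mulr1 (eq_bigr (lazy_walk e a x)) => [->|z _]; last by rewrite mulr1.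
rewrite sumr_const -[#|_|]/(#|[pred z | e x z]|).
have -> : #|[pred z | e x z]| = degree e x by apply: eq_card => z; rewrite !inE.
rewrite mulfVK ?pnatr_eq0 -?lt0n ?(degree_gt0 xy) //; ring.
Qed.

End LazyWalk.

Section CurvatureOfAnEdge.
Variables (R : realType) (T : finType) (e : rel T).
Hypotheses (sym_e : symmetric e) (irr_e : irreflexive e).
Variables x y : T.
Hypothesis xy : e x y.

Local Notation C := (component e x).
Local Notation mu a := (lazy_walk e a x).
Local Notation nu a := (lazy_walk e a y).

Lemma component_l : x \in C. Proof. by rewrite inE. Qed.
Lemma component_Nl z : e x z -> z \in C.
Proof. by rewrite inE => /connect1. Qed.
Lemma component_r : y \in C. Proof. exact: component_Nl. Qed.
Lemma component_Nr z : e y z -> z \in C.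
Proof. by rewrite inE => /connect1; apply: connect_trans; exact: connect1. Qed.

Lemma lazy_walk_total_l (a : R) : \sum_(z in C) mu a z = 1.
Proof. exact: lazy_walk_total xy component_l component_Nl. Qed.

Lemma lazy_walk_total_r (a : R) : \sum_(z in C) nu a z = 1.
Proof.
have yx : e y x by rewrite sym_e.
exact: lazy_walk_total yx component_r component_Nr.
Qed.

Lemma kappa_edge (a : R) : kappa e a x y = 1 - W1 e C (mu a) (nu a).
Proof. by rewrite /kappa gdist_edge // divr1. Qed.

Lemma kappa_ge (a : R) pi : coupling C (mu a) (nu a) pi ->
  1 - transport_cost e C pi <= kappa e a x y.
Proof. by move=> cpl; rewrite kappa_edge lerD2l lerN2 W1_le_cost. Qed.

(** The product plan shows that the infimum defining [W1] is over a nonempty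
    set; over the empty set it would be 0. *)
Lemma kappa_le (a b : R) : 0 <= a <= 1 ->
    (forall pi, coupling C (mu a) (nu a) pi -> b <= transport_cost e C pi) ->
  kappa e a x y <= 1 - b.
Proof.
move=> a01 le_b; rewrite kappa_edge lerD2l lerN2; apply: lb_le_inf.
  exists (transport_cost e C (fun u v => mu a u * nu a v)).
  exists (fun u v => mu a u * nu a v) => //.
  apply: coupling_product => [u|v||]; rewrite ?lazy_walk_ge0 //.
    exact: lazy_walk_total_l.
  exact: lazy_walk_total_r.
by move=> _ [pi cpl <-]; exact: le_b.
Qed.

Lemma kappa_gt (a b : R) : 0 <= a <= 1 -> b < kappa e a x y ->
  exists2 pi, coupling C (mu a) (nu a) pi & transport_cost e C pi < 1 - b.
Proof.
move=> a01 b_lt; have [//|no_pi] := pselect (exists2 pi,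
  coupling C (mu a) (nu a) pi & transport_cost e C pi < 1 - b).
suff : kappa e a x y <= 1 - (1 - b) by rewrite leNgt subKr b_lt.
apply: kappa_le => // pi cpl; rewrite leNgt; apply/negP => lt_b.
by apply: no_pi; exists pi.
Qed.

Lemma plan_integral1 (a : R) pi : coupling C (mu a) (nu a) pi ->
  plan_integral C pi (fun _ _ => 1) = 1.
Proof.
move=> cpl; rewrite (plan_integral_fst cpl (fun=> 1)).
by rewrite -[RHS](lazy_walk_total_l a); apply: eq_bigr => u _; rewrite mulr1.
Qed.

Lemma sum_lazy_walk_l (a : R) f : \sum_(z in C) mu a z * f z =
  a * f x + (1 - a) / (degree e x)%:R * \sum_(z | e x z) f z.
Proof. exact: sum_lazy_walk component_l component_Nl. Qed.

Lemma sum_lazy_walk_r (a : R) f : \sum_(z in C) nu a z * f z =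
  a * f y + (1 - a) / (degree e y)%:R * \sum_(z | e y z) f z.
Proof. exact: sum_lazy_walk component_r component_Nr. Qed.

(** All of this mass is of order [1 - a], because the walk at [x] hardly leaves
    [x] and the walk at [y] hardly reaches it. *)
Lemma mass_from_off_or_to_centre (a : R) pi : coupling C (mu a) (nu a) pi ->
  plan_integral C pi (fun u v => (u != x)%:R + (v == x)%:R) =
  (1 - a) * (1 + (degree e y)%:R^-1).
Proof.
move=> cpl; rewrite (plan_integralD _ _ (fun u _ => (u != x)%:R)).
rewrite (plan_integral_fst cpl (fun u => (u != x)%:R)).
rewrite (plan_integral_snd cpl (fun v => (v == x)%:R)).
rewrite (bigD1 x) ?component_l //= eqxx mulr0 add0r.
rewrite [X in _ + X](bigD1 x) ?component_l //= eqxx mulr1.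
rewrite [X in _ + (_ + X)]big1 ?addr0 => [|z /andP[_ /negPf ->]]; last exact: mulr0.
rewrite (lazy_walk_edge irr_e) 1?sym_e // mulrDr mulr1; congr (_ + _).
have := lazy_walk_total_l a; rewrite (bigD1 x) ?component_l //= lazy_walkxx.
move=> /(canRL (addKr a)); rewrite [- a + 1]addrC => <-.
by apply: eq_bigr => z /andP[_ ->]; rewrite mulr1.
Qed.

Lemma connect_component u v : u \in C -> v \in C -> connect e u v.
Proof. by rewrite !inE sym_connect_sym // => ux; exact: connect_trans. Qed.

(** The route [u x y v] has length 3 on these pairs and closes up with a
    geodesic to a pentagon, around which a form that is closed on triangles and
    quadrilaterals may have nonzero integral. *)
Definition far_move u v : bool :=
  [&& u != x, v != y & gdist e u v == 2%N].

Lemma far_move_neq u v : far_move u v -> u != v.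
Proof. by case/and3P=> _ _; apply: contraL => /eqP->; rewrite gdistxx. Qed.

(** A plan of cost below 1 must leave mass at rest, and more of it the more it
    moves to distance at least 2. *)
Lemma le_1B_gdist u v : u \in C -> v \in C ->
  1 - (gdist e u v)%:R <= (u == v)%:R - (far_move u v)%:R :> R.
Proof.
move=> uC vC; rewrite /far_move.
case Duv: (gdist e u v) => [|[|n]].
- by rewrite (gdist_eq0 (connect_component uC vC) Duv) eqxx !andbF subr0.
- by rewrite !andbF !subr0 subrr ler0n.
- have: ([&& u != x, v != y & n.+2 == 2%N] : nat)%:R <= (1 : R).
    by rewrite lern1; case: [&& _, _ & _].
  have : 0 <= ((u == v) : nat)%:R :> R by rewrite ler0n.
  have : 0 <= n%:R :> R by rewrite ler0n.
  by rewrite -[n.+2]addn2 natrD; lra.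
Qed.

(** Mass that rests at [x] ends at [x]; mass that rests elsewhere, like a far
    move, starts away from [x]. *)
Lemma far_move_bound u v :
  (u == v)%:R + (far_move u v)%:R <= (u != x)%:R + (v == x)%:R :> R.
Proof.
rewrite -!natrD ler_nat; have [-> {u}|_] := eqVneq u v.
  have /negPf-> : ~~ far_move v v by apply/negP => /far_move_neq; rewrite eqxx.
  by case: (v == x).
by rewrite /far_move; case: (u != x) => //=; case: (_ && _).
Qed.

(** Let [I] be the mass of the far moves and [Z] the mass at rest. The cost
    bound gives [Z - I > (1 - a) / 2], and if [degree y >= 2] then
    [Z + I <= 3 / 2 * (1 - a)] by [far_move_bound]; hence
    [I < (1 - a) / 2]. If [y] is a leaf there are no far moves: mass arriving
    at [v != y] arrives at [x], which is at distance at most 1 from all mass. *)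
Lemma coupling_far_move (a : R) pi :
    0 <= a <= 1 -> coupling C (mu a) (nu a) pi ->
    transport_cost e C pi < 1 - (1 - a) / 2 ->
  transport_cost e C pi + plan_integral C pi (fun u v => (far_move u v)%:R) < 1.
Proof.
set I := plan_integral _ _ _; move=> /andP[a0 a1] cpl cost_lt.
have [deg_y|deg_y] := leqP (degree e y) 1.
  suff: I <= 0 by lra.
  rewrite -(mul0r I) -plan_integralZ; apply: (le_plan_integral cpl).
  move=> u v _ _ /lazy_walk_support u_x /lazy_walk_support[->|yv]; rewrite mul0r.
    by rewrite /far_move eqxx andbF.
  have -> : v = x.
    have /card_le1_eqP : (#|[set z | e y z]%SET| <= 1)%N by [].
    by apply; rewrite inE // sym_e.
  rewrite /far_move; case: u_x => [->|xu]; first by rewrite eqxx.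
  by rewrite (@gdist_edge _ _ u x) ?andbF // sym_e.
pose Z := plan_integral C pi (fun u v => (u == v)%:R).
have cost_le : 1 - transport_cost e C pi <= Z - I.
  rewrite -(plan_integral1 cpl) transport_costE -!plan_integralB.
  by apply: (le_plan_integral cpl) => u v uC vC _ _; exact: le_1B_gdist.
have ZI_le : Z + I <= (1 - a) * (1 + (degree e y)%:R^-1).
  rewrite -(mass_from_off_or_to_centre cpl) -plan_integralD.
  by apply: (le_plan_integral cpl) => u v *; exact: far_move_bound.
have : (1 - a) * (degree e y)%:R^-1 <= (1 - a) * 2^-1.
  by rewrite ler_wpM2l ?subr_ge0 // lef_pV2 ?posrE ?ltr0n ?(ltn_trans _ deg_y) ?ler_nat.
by move: ZI_le; rewrite mulrDr mulr1; lra.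
Qed.

End CurvatureOfAnEdge.

(** * Existence of the limit curvature *)

Section LinLuYauLimit.
Local Open Scope classical_set_scope.
Local Open Scope ring_scope.
Variables (R : realType) (T : finType) (e : rel T).
Hypotheses (sym_e : symmetric e) (irr_e : irreflexive e).
Variables x y : T.
Hypothesis xy : e x y.

Local Notation C := (component e x).
Local Notation mu a := (lazy_walk e a x).
Local Notation nu a := (lazy_walk e a y).

(** The mass at rest is at most [2 * (1 - a)] and all other mass moves by at
    least 1. *)
Lemma kappa_le_2B (a : R) : 0 <= a <= 1 -> kappa e a x y <= 2 * (1 - a).
Proof.
move=> a01; have -> : 2 * (1 - a) = 1 - (1 - 2 * (1 - a)) by ring.
apply: kappa_le => // pi cpl; rewrite lerBlDr -lerBlDl.
have := mass_from_off_or_to_centre sym_e irr_e xy cpl.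
have : 1 - transport_cost e C pi <=
    plan_integral C pi (fun u v => (u != x)%:R + (v == x)%:R).
  rewrite -[X in X - _](plan_integral1 irr_e xy cpl) transport_costE -plan_integralB.
  apply: (le_plan_integral cpl) => u v uC vC _ _.
  apply: le_trans (le_1B_gdist R sym_e y uC vC) _.
  apply: le_trans (far_move_bound R e x y u v).
  by rewrite lerD2l (@le_trans _ _ 0) ?oppr_le0 ?ler0n.
move=> + E; rewrite E => /le_trans; apply; rewrite mulrC ler_wpM2r //.
  by case/andP: a01 => _; rewrite subr_ge0.
have y_gt0 : (0 < degree e y)%N by rewrite (@degree_gt0 _ _ _ x) // sym_e.
have : (degree e y)%:R^-1 <= 1 :> R by rewrite invf_le1 ?ltr0n // ler1n.
by move=> ?; lra.
Qed.

(** Slowing the walks down mixes in the pair of Dirac masses at [x] and [y],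
    whose transport cost is the length 1 of the edge. *)
Lemma coupling_slow_down (a b t : R) pi : 0 <= t <= 1 -> b = (1 - t) * a + t ->
    coupling C (mu a) (nu a) pi ->
  let pi' u v := (1 - t) * pi u v + t * ((u == x)%:R * (v == y)%:R) in
  coupling C (mu b) (nu b) pi' /\
  transport_cost e C pi' = (1 - t) * transport_cost e C pi + t.
Proof.
move=> /andP[t0 t1] b_eq cpl pi'; have [pi0 pi1 pi2] := cpl.
have xC := component_l e x; have yC := component_r xy; split; first split.
- by move=> u v uC vC; rewrite addr_ge0 // mulr_ge0 ?pi0 ?mulr_ge0 ?subr_ge0 ?ler0n.
- move=> u uC; rewrite (lazy_walk_mix e x u b_eq) -(pi1 u uC) big_split /=.
  by rewrite -!mulr_sumr sum_dirac1 // mulr1.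
- move=> v vC; rewrite (lazy_walk_mix e y v b_eq) -(pi2 v vC) big_split /=.
  by rewrite -!mulr_sumr -mulr_suml sum_dirac1 // mul1r.
rewrite !transport_costE.
have dirac_cost : plan_integral C (fun u v => (u == x)%:R * (v == y)%:R)
    (fun u v => (gdist e u v)%:R) = 1 :> R.
  transitivity (\sum_(u in C) (u == x)%:R * (gdist e u y)%:R : R).
    apply: eq_bigr => u _; rewrite -(sum_dirac (fun v => (gdist e u v)%:R) yC) mulr_sumr.
    by apply: eq_bigr => v _; rewrite mulrA.
  by rewrite sum_dirac // gdist_edge.
transitivity ((1 - t) * plan_integral C pi (fun u v => (gdist e u v)%:R) + t *
    plan_integral C (fun u v => (u == x)%:R * (v == y)%:R)
      (fun u v => (gdist e u v)%:R)); last by rewrite dirac_cost mulr1.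
rewrite /plan_integral !mulr_sumr -big_split /=; apply: eq_bigr => u _.
rewrite !mulr_sumr -big_split /=; apply: eq_bigr => v _.
rewrite /pi'; ring.
Qed.

(** By [coupling_slow_down], [1 - cost] scales by [(1 - b) / (1 - a)] when the
    idleness grows from [a] to [b]. *)
Lemma kappa_ratio_nondecreasing (a b : R) : 0 <= a -> a <= b -> b < 1 ->
  kappa e a x y / (1 - a) <= kappa e b x y / (1 - b).
Proof.
move=> a0 ab b1; have b1' : 0 < 1 - b by rewrite subr_gt0.
have a1' : 0 < 1 - a by rewrite subr_gt0 (le_lt_trans ab).
pose t := (b - a) / (1 - a); have t1 : 1 - t = (1 - b) / (1 - a).
  by rewrite /t; field; rewrite gt_eqF.
have t1_gt0 : 0 < 1 - t by rewrite t1 divr_gt0.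
have t0 : 0 <= t by rewrite divr_ge0 ?(ltW a1') // subr_ge0.
have b_eq : b = (1 - t) * a + t by rewrite /t; field; rewrite gt_eqF.
suff : kappa e a x y <= 1 - (1 - kappa e b x y / (1 - t)).
  rewrite subKr t1 ler_pdivrMr // => /le_trans; apply.
  by rewrite invf_div mulrA mulrAC.
apply: kappa_le => // [|pi cpl]; first by rewrite a0 -subr_ge0 ltW.
have t01 : 0 <= t <= 1 by rewrite t0 -subr_ge0 ltW.
have [cpl' cost'] := coupling_slow_down t01 b_eq cpl.
rewrite lerBlDr -lerBlDl ler_pdivlMr //; apply: le_trans (kappa_ge irr_e xy cpl').
by rewrite cost' le_eqVlt; apply/orP; left; apply/eqP; ring.
Qed.

Lemma kappa_LLY_is_cvg : cvg (kappa e a x y / (1 - a) @[a --> (1 : R)^'-]).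
Proof.
have itv01 : \forall b \near (1 : R)^'-, 0 < b < 1.
  by near=> b; apply/andP; split; near: b; [exact: nbhs_left_gt|exact: nbhs_left_lt].
apply: nondecreasing_at_left_is_cvgr.
- apply: filterS itv01 => c /andP[c0 _] a b; rewrite !in_itv /=.
  move=> /andP[ca _] /andP[_ b1] ab; apply: kappa_ratio_nondecreasing => //.
  by rewrite ltW // (lt_trans c0).
- apply: filterS itv01 => c /andP[c0 _]; exists 2 => _ [a + <-].
  rewrite /= in_itv /= => /andP[ca a1]; rewrite ler_pdivrMr ?subr_gt0 //.
  by rewrite kappa_le_2B // !ltW // (lt_trans c0).
Unshelve. all: by end_near. Qed.

Lemma kappa_LLY_ge (a : R) : 0 <= a < 1 ->
  kappa e a x y / (1 - a) <= kappa_LLY R e x y.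
Proof.
move=> /andP[a0 a1]; apply: limr_ge; first exact: kappa_LLY_is_cvg.
near=> b; have ab : a < b by near: b; exact: nbhs_left_gt.
by apply: kappa_ratio_nondecreasing => //; exact: ltW.
Unshelve. all: by end_near. Qed.

Lemma kappa_LLY_gt (b : R) : b < kappa_LLY R e x y ->
  exists2 a : R, 0 <= a < 1 & b * (1 - a) < kappa e a x y.
Proof.
move=> b_lt; have b_near := @cvgr_gt _ _ _ _ _ _ kappa_LLY_is_cvg _ b_lt.
near (1 : R)^'- => a.
have a0 : 0 < a by near: a; exact: nbhs_left_gt.
have a1 : a < 1 by near: a; exact: nbhs_left_lt.
have ab : b < kappa e a x y / (1 - a) by near: a; exact: b_near.
exists a; first by rewrite ltW.
by rewrite -ltr_pdivlMr ?subr_gt0.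
Unshelve. all: by end_near. Qed.

End LinLuYauLimit.

(** * Maximum principle for harmonic forms *)

Section MaximumPrinciple.
Variables (R : realType) (T : finType) (e : rel T).
Hypotheses (sym_e : symmetric e) (irr_e : irreflexive e).

(** The quadrilaterals may be degenerate, and [form_divergence] has the
    weights of the uniform walk up to the factor [1 / degree a]. *)
Record harmonic_form (w : T -> T -> R) : Prop := HarmonicForm {
  form_off_edges : forall a b, ~~ e a b -> w a b = 0;
  form_anti : forall a b, w b a = - w a b;
  form_triangle : forall a b c, e a b -> e b c -> e a c ->
    w a b + w b c = w a c;
  form_square : forall a b c d, e a b -> e b c -> e a d -> e d c ->
    w a b + w b c = w a d + w d c;
  form_divergence : forall a, \sum_(b | e a b) w a b = 0 }.

Variable w : T -> T -> R.
Hypothesis harm_w : harmonic_form w.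

Lemma form_diag a : w a a = 0.
Proof. by rewrite (form_off_edges harm_w) // irr_e. Qed.

(** The closed walk [x y v u] is a quadrilateral, a triangle or a back-and-forth
    walk on an edge. *)
Lemma form_transport x y u v : e x y -> u = x \/ e x u -> v = y \/ e y v ->
  e u v -> w x y + w y v - w x u = w u v.
Proof.
move=> xy [->|xu] [->|yv] uv; rewrite ?form_diag ?addr0 ?subr0 //.
- by rewrite (form_triangle harm_w).
- by rewrite -(form_triangle harm_w xu uv xy) addrC addKr.
- by rewrite (form_square harm_w xy yv xu uv) addrC addKr.
Qed.

Lemma form_transport_eq x y u : e x y -> u = x \/ e x u -> u = y \/ e y u ->
  w x y + w y u - w x u = 0.
Proof.
move=> xy [->|xu] [yu|yu].
- by rewrite yu irr_e in xy.
- by rewrite form_diag (form_anti harm_w x y) subrr subr0.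
- by rewrite yu form_diag addr0 subrr.
- by rewrite (form_triangle harm_w xy yu xu) subrr.
Qed.

(** With [M = w x y], [M + w y v - w x u] is the integral of [w] along
    [u x y v]. Its mean over a plan is [M], while pointwise it is at most
    [M * (d(u, v) + 1)] on far moves and [M * d(u, v)] otherwise. *)
Theorem harmonic_form_max_eq0 x y : e x y ->
    (forall a b, w a b <= w x y) -> 1 / 2 < kappa_LLY R e x y ->
  w x y = 0.
Proof.
move=> xy max_w /(kappa_LLY_gt sym_e irr_e xy)[a /andP[a0 a1] a_kappa].
have a01 : 0 <= a <= 1 by rewrite a0 ltW.
set M := w x y in max_w *.
have M_ge0 : 0 <= M by rewrite -(form_diag x).
have [pi cpl cost_lt] := kappa_gt sym_e irr_e xy a01 a_kappa.
have {}cost_lt : transport_cost e (component e x) pi < 1 - (1 - a) / 2.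
  by apply: lt_le_trans cost_lt _; lra.
have cost_far := coupling_far_move sym_e irr_e xy a01 cpl cost_lt.
set C := component e x in cpl cost_lt cost_far.
pose I u v : R := (far_move e x y u v)%:R.
have mean_w : plan_integral C pi (fun u v => M * 1 + w y v - w x u) = M.
  rewrite plan_integralB (plan_integralD _ _ _ (fun _ v => w y v)).
  rewrite plan_integralZ (plan_integral1 irr_e xy cpl).
  rewrite (plan_integral_snd cpl (w y)) (plan_integral_fst cpl (w x)).
  rewrite (sum_lazy_walk_l irr_e) (sum_lazy_walk_r irr_e) //.
  by rewrite !form_diag !(form_divergence harm_w) !mulr0 !addr0 subr0 mulr1.
have : M <= M * plan_integral C pi (fun u v => (gdist e u v)%:R + I u v).
  rewrite -[leLHS]mean_w -plan_integralZ; apply: (le_plan_integral cpl).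
  move=> u v uC vC /lazy_walk_support u_x /lazy_walk_support v_y; rewrite mulr1.
  have I_ge0 : 0 <= I u v by rewrite ler0n.
  have uv := connect_component sym_e uC vC.
  have w_yv : w y v <= M := max_w y v.
  have w_xu : - w x u <= M by rewrite -(form_anti harm_w) max_w.
  case Duv: (gdist e u v) => [|[|n]].
  - move: v_y; rewrite -(gdist_eq0 uv Duv) => u_y.
    by rewrite /M form_transport_eq // mulr_ge0 // add0r.
  - rewrite /M form_transport //; last exact: gdist_eq1 uv Duv.
    by apply: le_trans (max_w u v) _; rewrite ler_peMr // lerDl.
  (* from distance 3 on, the trivial bound of the integral by 3 M suffices *)
  have [n0|n_gt0] := posnP n; last first.
    have : M * 3 <= M * (n.+2%:R + I u v).
      rewrite ler_wpM2l //; apply: ler_wpDr => //.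
      by rewrite -[3]/(3%:R) ler_nat.
    by lra.
  rewrite /I /far_move Duv n0 andbT.
  have [ux|_] := eqVneq u x; first by rewrite ux form_diag /= addr0; lra.
  have [vy|_] := eqVneq v y; first by rewrite vy form_diag /= addr0; lra.
  by rewrite /=; lra.
rewrite plan_integralD -transport_costE => M_le.
apply/eqP; rewrite eq_le M_ge0 andbT leNgt; apply/negP => M_gt0.
by move: M_le; rewrite ler_pMr // leNgt cost_far.
Qed.

End MaximumPrinciple.

(** * Chains of paths and first homology *)

Section PathChains.
Variables (F : fieldType) (T : finType).
Local Notation chain := (chain F T).

Lemma elem_irregular p (t : p.+1.-tuple T) : ~~ regular_path t -> elem F t = 0.
Proof.
move=> irr_t; apply/ffunP => s; rewrite !ffunE; case: eqP => // s_t.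
by rewrite -s_t (valP s) in irr_t.
Qed.

Lemma sum_elem (V : lmodType F) p (s0 : regpath T p) (f : regpath T p -> V) :
  \sum_s (elem F (val s0) s : F) *: f s = f s0.
Proof.
rewrite (bigD1 s0) //= ffunE eqxx scale1r big1 ?addr0 // => s /negPf s_s0.
by rewrite ffunE (inj_eq val_inj) s_s0 scale0r.
Qed.

Lemma boundary_elem p (t : p.+2.-tuple T) : regular_path t ->
  boundary F T p (elem F t) = \sum_(q < p.+2) (-1) ^+ q *: elem F (del q t).
Proof. by move=> reg_t; rewrite lfunE /= /boundary_fun (sum_elem (Sub t reg_t)). Qed.

Lemma boundary_elem1 a b : boundary F T 0 (elem F [tuple a; b]) =
  elem F [tuple b] - elem F [tuple a].
Proof.
have [<-{b}|ab] := eqVneq a b.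
  by rewrite subrr elem_irregular ?linear0 // /regular_path /= eqxx.
rewrite boundary_elem /regular_path /= ?ab //.
rewrite !big_ord_recl big_ord0 /= addr0 scale1r scaleN1r.
congr (elem F _ - elem F _); apply: eq_from_tnth => -[[|//] ?];
  by rewrite tnth_mktuple !(tnth_nth a).
Qed.

Lemma boundary_elem2 a b c : a != b -> b != c ->
  boundary F T 1 (elem F [tuple a; b; c]) =
  elem F [tuple b; c] - elem F [tuple a; c] + elem F [tuple a; b].
Proof.
move=> ab bc; rewrite boundary_elem /regular_path /= ?ab ?bc //.
rewrite !big_ord_recl big_ord0 /= addr0 scale1r scaleN1r addrA.
rewrite /bump /= expr2 mulrNN mulr1 scale1r.
congr (elem F _ - elem F _ + elem F _); apply: eq_from_tnth => -[[|[|//]] ?];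
  by rewrite tnth_mktuple !(tnth_nth a).
Qed.

Definition dot p (z c : chain p) : F^o := \sum_s z s * c s.

Lemma dot_is_linear p (z : chain p) : linear (dot z : chain p -> F^o).
Proof.
move=> a b c; rewrite /dot scaler_sumr -big_split /=; apply: eq_bigr => s _.
by rewrite !ffunE mulrDr; congr (_ + _); rewrite mulrCA.
Qed.
HB.instance Definition _ p (z : chain p) :=
  GRing.isLinear.Build F (chain p) F^o _ (dot z) (dot_is_linear z).

Lemma dotC p (z c : chain p) : dot z c = dot c z.
Proof. by apply: eq_bigr => s _; rewrite mulrC. Qed.

Lemma dot_elem p (z : chain p) (s : regpath T p) : dot z (elem F (val s)) = z s.
Proof. by rewrite dotC; exact: (sum_elem s (z : _ -> F^o)). Qed.

Definition dots p k (X : k.-tuple (chain p)) (z : chain p) : 'rV[F]_k :=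
  \row_i dot X`_i z.

Lemma dots_is_linear p k (X : k.-tuple (chain p)) : linear (dots X).
Proof. by move=> a b c; apply/rowP => i; rewrite !mxE linearP. Qed.
HB.instance Definition _ p k (X : k.-tuple (chain p)) :=
  GRing.isLinear.Build F (chain p) 'rV[F]_k _ (dots X) (dots_is_linear X).

(** Inside [U], the pairings with a basis of [U :&: V] cut out a subspace of
    codimension at most [\dim (U :&: V) < \dim U]. This holds over any field,
    whether or not [dot] is definite. *)
Lemma orthogonal_exists p (U V : {vspace chain p}) : ~~ (U <= V)%VS ->
  exists z, [/\ z \in U, z != 0 & forall c, c \in (U :&: V)%VS -> dot z c = 0].
Proof.
move=> UV; set W := (U :&: V)%VS; set X := vbasis W.
pose f := linfun (dots X).
have W_lt : (\dim W < \dim U)%N.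
  rewrite ltn_neqAle (dimvS (capvSl _ _)) andbT.
  by apply: contra UV; rewrite (dimv_leqif_eq (capvSl _ _)) => /eqP/capv_idPl.
have ker_gt0 : (0 < \dim (U :&: lker f))%N.
  rewrite -(ltn_add2r (\dim (f @: U))) add0n limg_ker_dim.
  apply: leq_ltn_trans W_lt.
  by apply: leq_trans (dimvS (subvf _)) _; rewrite dimvf dim_matrix mul1r.
have [z_UK z0] : vpick (U :&: lker f) \in (U :&: lker f)%VS /\ vpick (U :&: lker f) != 0.
  by rewrite memv_pick vpick0 -dimv_eq0 -lt0n.
move: (vpick _) z_UK z0 => z; rewrite memv_cap memv_ker lfunE /=.
move=> /andP[zU /eqP/rowP zX] z0; exists z; split=> // c cW.
rewrite (coord_vbasis cW) linear_sum big1 // => i _; rewrite linearZ /= dotC.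
by have := zX i; rewrite !mxE => ->; rewrite scaler0.
Qed.

(** The evaluation at [s] is a linear form that kills the generators. *)
Lemma allowed_support (E : rel T) p (c : chain p) (s : regpath T p) :
  c \in allowed F E p -> ~~ sorted E (val s) -> c s = 0.
Proof.
move=> c_al s_E; rewrite -dot_elem dotC; apply/eqP.
pose f := linfun (dot (elem F (val s)) : chain p -> F^o).
have /subvP/(_ c c_al) : (allowed F E p <= lker f)%VS.
  apply/span_subvP => _ /mapP[s' + ->]; rewrite mem_enum inE => s'E.
  rewrite memv_ker lfunE /= dotC dot_elem ffunE.
  by case: (val s =P val s') => // ss'; rewrite ss' s'E in s_E.
by rewrite memv_ker lfunE.
Qed.

Lemma elem_allowed (E : rel T) p (t : p.+1.-tuple T) :
  sorted E t -> elem F t \in allowed F E p.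
Proof.
move=> t_E; have [reg_t|irr_t] := boolP (regular_path t).
  by apply: memv_span; apply/mapP; exists (Sub t reg_t); rewrite ?mem_enum.
by rewrite elem_irregular ?mem0v.
Qed.

Lemma mem_boundaries (E : rel T) p (c : chain p.+1) : c \in allowed F E p.+1 ->
  boundary F T p c \in allowed F E p -> boundary F T p c \in boundaries F E p.
Proof. by move=> *; apply: memv_img; rewrite memv_cap -memv_preim; apply/andP. Qed.

Lemma mem_cycles1 (E : rel T) (c : chain 1) :
  (c \in cycles F E 1) = (c \in allowed F E 1) && (boundary F T 0 c == 0).
Proof.
rewrite !memv_cap memv_ker -memv_preim; case: (_ \in allowed F E 1) => //=.
by case: eqP => [->|_]; rewrite ?mem0v ?andbF.
Qed.

Variable E : rel T.

Lemma homology_pi_eq0 p (z : subvs_of (cycles F E p)) :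
  (\pi_(GLMY_homology F E p)%qT z == 0) = (vsval z \in boundaries F E p).
Proof.
pose I := GRing.ZmodClosed.clone _ (pred_of_vspace (boundaries_in_cycles F E p)) _.
transitivity (z - 0 \in I).
  by rewrite Quotient.idealrBE; congr (_ == _); rewrite raddf0.
by rewrite subr0 -memv_preim lfunE.
Qed.

Lemma homology_eq0 p : (cycles F E p <= boundaries F E p)%VS ->
  forall h : GLMY_homology F E p, h = 0.
Proof.
move=> /subvP ZB; apply: quotW => z; apply/eqP.
by rewrite homology_pi_eq0 ZB ?subvsP.
Qed.

Lemma homology_neq0 p c : c \in cycles F E p -> c \notin boundaries F E p ->
  exists h : GLMY_homology F E p, h <> 0.
Proof.
move=> cZ cB; exists (\pi_(GLMY_homology F E p)%qT (vsproj (cycles F E p) c)).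
by apply/eqP; rewrite homology_pi_eq0 vsprojK.
Qed.

End PathChains.

Section OneChains.
Variables (F : fieldType) (T : finType).
Local Notation arc a b := (elem F [tuple a; b]).

Lemma elem_loop a : elem F [tuple a; a] = 0 :> chain F T 1.
Proof. by rewrite elem_irregular // /regular_path /= eqxx. Qed.

Lemma regpath1E (s : regpath T 1) : exists2 ab : T * T,
  ab.1 != ab.2 & val s = [tuple ab.1; ab.2].
Proof.
case: s => -[[|a [|b [|//]]]] // sz reg_ab; exists (a, b).
  by move: reg_ab; rewrite /regular_path /= andbT.
exact: val_inj.
Qed.

Lemma chain1_expand (z : chain F T 1) :
  z = \sum_a \sum_b dot z (arc a b) *: arc a b.
Proof.
rewrite pair_big /=; apply/ffunP => s.
have [ab _ s_ab] := regpath1E s.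
rewrite (bigD1 ab) //= -s_ab dot_elem ffunE sum_ffunE big1 => [|cd cd_ab]; last first.
  rewrite !ffunE s_ab.
  suff /negPf-> : [tuple ab.1; ab.2] != [tuple cd.1; cd.2] by rewrite mulr0n scaler0.
  apply: contra cd_ab => /eqP/(congr1 val)[ab1 ab2].
  by apply/eqP; case: cd ab1 ab2 => c d /= <- <-; case: ab {s_ab}.
by rewrite !ffunE eqxx addr0 /= -[_ *: _]/(_ * _) mulr1.
Qed.

Lemma boundary_chain1 (z : chain F T 1) x (X : regpath T 0) :
    val X = [tuple x] ->
  boundary F T 0 z X =
  \sum_a dot z (arc a x) - \sum_b dot z (arc x b).
Proof.
move=> valX; have elemX a : (val X == [tuple a])%:R = (a == x)%:R :> F.
  congr (_ : bool)%:R; rewrite valX.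
  by apply/eqP/eqP => [/(congr1 val)[]|->].
have sum_x (f : T -> F) : \sum_a f a * (a == x)%:R = f x.
  rewrite (bigD1 x) //= eqxx mulr1 big1 ?addr0 // => a /negPf->.
  by rewrite mulr0.
rewrite [in LHS](chain1_expand z) linear_sum sum_ffunE.
under eq_bigr => a _ do (rewrite linear_sum sum_ffunE;
  under eq_bigr => b _ do rewrite linearZ /= boundary_elem1 !ffunE !elemX
    -[_ *: _]/(_ * _) mulrBr).
under eq_bigr => a _ do rewrite sumrB sum_x -mulr_suml.
by rewrite sumrB sum_x.
Qed.

End OneChains.

(** * Harmonic representatives and vanishing *)

Section HarmonicRepresentative.
Variables (R : realType) (T : finType) (e : rel T).
Hypotheses (sym_e : symmetric e) (irr_e : irreflexive e).
Local Notation arc a b := (elem R [tuple a; b]).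

Lemma edge_neq a b : e a b -> a != b.
Proof. by apply: contraTneq => ->; rewrite irr_e. Qed.

Lemma arc_allowed a b : e a b -> arc a b \in allowed R e 1.
Proof. by move=> ab; apply: elem_allowed; rewrite /= ab. Qed.

Variable z : chain R T 1.
Hypothesis z_cycle : z \in cycles R e 1.
Hypothesis z_orth :
  forall c, c \in (cycles R e 1 :&: boundaries R e 1)%VS -> dot z c = 0.

Lemma dot_boundary (c : chain R T 2) : c \in allowed R e 2 ->
    boundary R T 1 c \in allowed R e 1 ->
    boundary R T 0 (boundary R T 1 c) = 0 ->
  dot z (boundary R T 1 c) = 0.
Proof.
move=> c_al dc_al ddc0; apply: z_orth.
by rewrite memv_cap mem_boundaries // mem_cycles1 dc_al ddc0 eqxx.
Qed.

(** Antisymmetry comes from the path [aba], the triangle rule from [abc] and the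
    square rule from [abc - adc], whose faces [ac] cancel. The cycle condition
    at [a] equates the flow into [a] with the flow out of [a]; these are opposite
    by antisymmetry, so both vanish. *)
Lemma harmonic_representative : harmonic_form e (fun a b => dot z (arc a b)).
Proof.
have z_al : z \in allowed R e 1 by move: z_cycle; rewrite mem_cycles1 => /andP[].
have off a b : ~~ e a b -> dot z (arc a b) = 0.
  have [<-|ab] := eqVneq a b; first by rewrite elem_loop linear0.
  move=> Nab; have reg_ab : regular_path [tuple a; b] by rewrite /regular_path /= ab.
  rewrite (dot_elem z (Sub [tuple a; b] reg_ab)) (allowed_support z_al) //=.
  by rewrite andbT.
have anti a b : dot z (arc b a) = - dot z (arc a b).
  have [ab|Nab] := boolP (e a b); last by rewrite !off ?oppr0 // sym_e.
  have ba : e b a by rewrite sym_e.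
  have aba := boundary_elem2 R (edge_neq ab) (edge_neq ba).
  rewrite elem_loop subr0 in aba.
  apply/eqP; rewrite -addr_eq0 -linearD /= -aba dot_boundary //.
  - by apply: elem_allowed; rewrite /= ab ba.
  - by rewrite aba rpredD ?arc_allowed.
  - by rewrite aba linearD /= !boundary_elem1 addrC subrKA subrr.
split=> //.
- move=> a b c ab bc ac; have abc := boundary_elem2 R (edge_neq ab) (edge_neq bc).
  have : dot z (arc b c - arc a c + arc a b) = 0.
    rewrite -abc dot_boundary //.
    - by apply: elem_allowed; rewrite /= ab bc.
    - by rewrite abc rpredD ?rpredB ?arc_allowed.
    - rewrite abc linearD linearB /= !boundary_elem1.
      by apply/ffunP => s; rewrite !ffunE; ring.
  rewrite linearD linearB /= addrAC => /eqP.
  by rewrite subr_eq0 addrC => /eqP.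
- move=> a b c d ab bc ad dc.
  have abc := boundary_elem2 R (edge_neq ab) (edge_neq bc).
  have adc := boundary_elem2 R (edge_neq ad) (edge_neq dc).
  have abcd : boundary R T 1 (elem R [tuple a; b; c] - elem R [tuple a; d; c]) =
      arc a b + arc b c - (arc a d + arc d c).
    rewrite linearB /= abc adc.
    by apply/ffunP => s; rewrite !ffunE; ring.
  apply/eqP; rewrite -subr_eq0 -!linearD -linearB /= -abcd dot_boundary //.
  - by rewrite rpredB //; apply: elem_allowed; rewrite /= ?ab ?bc ?ad ?dc.
  - by rewrite abcd rpredB ?rpredD ?arc_allowed.
  - rewrite abcd linearB !linearD /= !boundary_elem1.
    by apply/ffunP => s; rewrite !ffunE; ring.
move=> a; have reg_a : regular_path [tuple a] by [].
have := boundary_chain1 z (erefl (val (Sub [tuple a] reg_a : regpath T 0))).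
move: z_cycle; rewrite mem_cycles1 => /andP[_ /eqP ->]; rewrite ffunE.
under eq_bigr => b _ do rewrite anti.
rewrite sumrN -opprD => /esym/eqP; rewrite oppr_eq0 -mulr2n mulrn_eq0 /=.
move=> /eqP sum0; rewrite -[RHS]sum0 [RHS](bigID (e a)) /=.
by rewrite [X in _ + X]big1 ?addr0 // => b /off.
Qed.

End HarmonicRepresentative.

Section Vanishing.
Variables (R : realType) (T : finType) (e : rel T).
Hypotheses (sym_e : symmetric e) (irr_e : irreflexive e).

Theorem homology1_eq0 : (forall x y, e x y -> 1 / 2 < kappa_LLY R e x y) ->
  forall h : GLMY_homology R e 1, h = 0.
Proof.
move=> curv; apply: homology_eq0; apply/negPn/negP => ZB.
have [z [z_cycle z0 z_orth]] := orthogonal_exists ZB.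
have harm := harmonic_representative sym_e irr_e z_cycle z_orth.
set w := fun a b => _ in harm.
case/negP: z0; apply/eqP/ffunP => s; rewrite [RHS]ffunE -dot_elem.
have [[a b] /= _ ->] := regpath1E s; rewrite -/(w a b).
have [[x y] _ max_w] := @arg_maxP _ R _ (a, b) xpredT (fun p => w p.1 p.2) isT.
have {}max_w c d : w c d <= w x y := max_w (c, d) isT.
have w_xy : w x y = 0.
  have [xy|/(form_off_edges harm)//] := boolP (e x y).
  exact: (harmonic_form_max_eq0 sym_e irr_e harm xy max_w (curv _ _ xy)).
rewrite w_xy in max_w; apply/eqP; rewrite eq_le max_w -oppr_le0.
by rewrite -(form_anti harm) max_w.
Qed.

Lemma kappa_min_le x y : e x y -> kappa_min R e <= kappa_LLY R e x y.
Proof.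
move=> xy; apply: ge_bigmin_seq => //.
by apply: (map_f _ (x := (x, y))); rewrite mem_enum.
Qed.

Lemma kappa_min_gt c : (exists x y, e x y) ->
  (forall x y, e x y -> c < kappa_LLY R e x y) -> c < kappa_min R e.
Proof.
move=> [x [y xy]] c_lt; rewrite /kappa_min; set s := [seq _ | _ in _].
have c_lt_s k : k \in s -> c < k.
  by move=> /mapP[[a b]]; rewrite mem_enum => /c_lt ab ->.
rewrite big_seq_cond; apply: lt_bigmin => [|k /andP[/c_lt_s]//].
apply: c_lt_s; rewrite -nth0 mem_nth // size_map -cardE.
by apply/card_gt0P; exists (x, y).
Qed.

End Vanishing.

(** * Sharpness: the pentagon *)

Section NonVanishing.
Variables (F : fieldType) (T : finType) (e : rel T) (w : T -> T -> F).
Hypothesis w_diag : forall a, w a a = 0.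

Definition form_chain : chain F T 1 :=
  [ffun s => w (tnth (val s) ord0) (tnth (val s) ord_max)].

Lemma dot_form_chain a b : dot form_chain (elem F [tuple a; b]) = w a b.
Proof.
have [<-|ab] := eqVneq a b; first by rewrite w_diag elem_loop linear0.
have reg_ab : regular_path [tuple a; b] by rewrite /regular_path /= ab.
by rewrite (dot_elem _ (Sub [tuple a; b] reg_ab)) ffunE.
Qed.

Lemma dot_form_boundaries c :
    (forall i j k, e i j -> e j k -> w i j + w j k = w i k) ->
  c \in boundaries F e 1 -> dot form_chain c = 0.
Proof.
move=> w_add /memv_imgP[u + ->]; rewrite memv_cap => /andP[u_al _].
pose f : 'Hom(chain F T 2, F^o) :=
  (linfun (dot form_chain : chain F T 1 -> F^o) \o boundary F T 1)%VF.
suff /subvP/(_ u u_al) : (allowed F e 2 <= lker f)%VS.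
  by rewrite memv_ker /f comp_lfunE lfunE => /eqP.
apply/span_subvP => _ /mapP[s + ->]; rewrite mem_enum inE memv_ker /f.
rewrite comp_lfunE lfunE /=.
case: s => -[[|i [|j [|k [|//]]]] // sz reg_ijk] /= /and3P[ij jk _].
have -> : Tuple sz = [tuple i; j; k] by exact: val_inj.
have /and3P[i_j j_k _] := reg_ijk.
rewrite boundary_elem2 // linearD linearB /= !dot_form_chain.
by rewrite -(w_add _ _ _ ij jk) addrAC [X in X - _]addrC subrr.
Qed.

(** Additivity also fixes the values of [w] on the non-edges [(i, k)] spanned by
    allowed 2-paths, so [w] kills the boundary of every allowed 2-chain, and
    [Omega] need not be computed. *)
Lemma homology1_neq0 c :
    (forall i j k, e i j -> e j k -> w i j + w j k = w i k) ->
    c \in cycles F e 1 -> dot form_chain c != 0 ->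
  exists h : GLMY_homology F e 1, h <> 0.
Proof.
move=> w_add c_cycle period; apply: homology_neq0 c_cycle _.
by apply: contra period => /(dot_form_boundaries w_add) ->.
Qed.

End NonVanishing.

Section DegreeTwo.
Variables (R : realType) (T : finType) (e : rel T).
Hypotheses (sym_e : symmetric e) (irr_e : irreflexive e).

(** At idleness 1/3 the walks are uniform on the balls [{x, y, u}] and
    [{x, y, v}]. Moving only [u] to [v] costs at most 2/3, so the ratio
    [kappa_a / (1 - a)], which increases to the curvature, is at least
    [(1/3) / (2/3)]. *)
Lemma kappa_LLY_degree_two x y u v : u != y -> v != x ->
    e x =1 [pred z | (z == y) || (z == u)] ->
    e y =1 [pred z | (z == x) || (z == v)] ->
    (gdist e u v <= 2)%N ->
  1 / 2 <= kappa_LLY R e x y.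
Proof.
move=> uy vx Nx Ny duv.
have xy : e x y by rewrite Nx /= eqxx.
have xu : e x u by rewrite Nx /= eqxx orbT.
have yv : e y v by rewrite Ny /= eqxx orbT.
have neq a b : e a b -> a != b := @edge_neq _ _ irr_e a b.
pose a : R := 3^-1.
have lazyE s t r : r != t -> e s =1 [pred z | (z == t) || (z == r)] ->
  forall z, lazy_walk e a s z =
    3^-1 * ((z == s)%:R + (z == t)%:R + (z == r)%:R).
  move=> rt Ns z; have deg_s : degree e s = 2.
    transitivity #|[set t; r]%SET|; last by rewrite cards2 eq_sym rt.
    by apply: eq_card => z'; rewrite !inE Ns.
  have st : s != t by apply: neq; rewrite Ns /= eqxx.
  have sr : s != r by apply: neq; rewrite Ns /= eqxx orbT.
  rewrite /lazy_walk deg_s Ns /=.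
  have [->|zs] := eqVneq z s; first by rewrite (negPf st) (negPf sr) !addr0 mulr1.
  have [->|zt] := eqVneq z t; first by rewrite eq_sym (negPf rt) /= /a; field.
  by case: eqP => _; rewrite /= /a; field.
pose pi p q : R := 3^-1 * ((p == x)%:R * (q == x)%:R + (p == y)%:R * (q == y)%:R
   + (p == u)%:R * (q == v)%:R).
have xC := component_l e x; have yC := component_r xy.
have uC := component_Nl xu; have vC := component_Nr xy yv.
have cpl : coupling (component e x) (lazy_walk e a x) (lazy_walk e a y) pi.
  split=> [p q _ _|p _|q _].
  - by rewrite mulr_ge0 ?invr_ge0 ?addr_ge0 ?mulr_ge0 ?ler0n.
  - rewrite (lazyE x y u uy Nx) -mulr_sumr !big_split /= -!mulr_sumr.
    by rewrite !sum_dirac1 // !mulr1.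
  - rewrite (lazyE y x v vx Ny) -mulr_sumr !big_split /= -!mulr_suml.
    by rewrite !sum_dirac1 // !mul1r; congr (_ * (_ + _)); rewrite addrC.
have le_cost : transport_cost e (component e x) pi <= 2 / 3.
  rewrite transport_costE.
  have -> : plan_integral (component e x) pi (fun p q => (gdist e p q)%:R) =
      3^-1 * \sum_(p in component e x) \sum_(q in component e x)
        ((p == x)%:R * ((q == x)%:R * (gdist e p q)%:R) +
         (p == y)%:R * ((q == y)%:R * (gdist e p q)%:R) +
         (p == u)%:R * ((q == v)%:R * (gdist e p q)%:R)).
    rewrite mulr_sumr; apply: eq_bigr => p _; rewrite mulr_sumr.
    by apply: eq_bigr => q _; rewrite /pi; ring.
  under eq_bigr => p _ do rewrite !big_split /= -!mulr_sumr !sum_dirac //.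
  rewrite !big_split /= !sum_dirac // !gdistxx !add0r mulrC.
  by rewrite ler_pM2r ?invr_gt0 ?ltr0n // (ler_nat _ _ 2).
have a01 : 0 <= a < 1 by rewrite invr_ge0 ler0n invf_lt1 ?ltr0n ?ltr1n.
apply: le_trans (kappa_LLY_ge sym_e irr_e xy a01).
rewrite ler_pdivlMr ?subr_gt0; last by case/andP: a01.
apply: le_trans (kappa_ge irr_e xy cpl); rewrite /a; lra.
Qed.

End DegreeTwo.

Section Pentagon.

Definition pentagon (i j : 'I_5) : bool := (j == ordS i) || (i == ordS j).

Lemma pentagon_sym : symmetric pentagon.
Proof. by move=> i j; rewrite /pentagon orbC. Qed.

Lemma pentagon_irr : irreflexive pentagon.
Proof. by case=> [[|[|[|[|[|//]]]]] ?]. Qed.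

(** The representative in [-2, 2] of [j - i] modulo 5; the summand 7 is the
    shift by 2 plus a 5 that keeps the subtraction of naturals exact. Non-edges
    get the values +2 and -2, the sums of the values along the 2-path that joins
    their ends. *)
Definition winding (F : fieldType) (i j : 'I_5) : F :=
  ((j + 7 - i) %% 5)%:R - 2%:R.

Lemma winding_diag F i : winding F i i = 0.
Proof. by case: i => [[|[|[|[|[|//]]]]] ?]; rewrite /winding /= subrr. Qed.

Lemma winding_add F i j k : pentagon i j -> pentagon j k ->
  winding F i j + winding F j k = winding F i k.
Proof.
move=> ij jk.
have : ((j + 7 - i) %% 5 + (k + 7 - j) %% 5 = (k + 7 - i) %% 5 + 2)%N.
  move: ij jk; case: i => [[|[|[|[|[|//]]]]] ?]; case: j => [[|[|[|[|[|//]]]]] ?];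
  by case: k => [[|[|[|[|[|//]]]]] ?].
rewrite /winding => eq_sum; rewrite addrACA -natrD eq_sum natrD.
by rewrite [X in X + _]addrC addrAC addrA subrr add0r addrC.
Qed.

Lemma pentagon_kappa_LLY (R : realType) x y :
  pentagon x y -> 1 / 2 <= kappa_LLY R pentagon x y.
Proof.
(* modulo 5, the other neighbours of [x] and [y] are [2 x - y] and [2 y - x];
   the vertex opposite to the edge [x y] is [3 (x + y)] *)
pose I5 n : 'I_5 := Ordinal (ltn_pmod n (isT : (0 < 5)%N)).
move=> xy; apply: (@kappa_LLY_degree_two _ _ _ pentagon_sym pentagon_irr x y
  (I5 (2 * x + 4 * y)) (I5 (2 * y + 4 * x)))%N.
- by move: xy; case: x => [[|[|[|[|[|//]]]]] ?]; case: y => [[|[|[|[|[|//]]]]] ?].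
- by move: xy; case: x => [[|[|[|[|[|//]]]]] ?]; case: y => [[|[|[|[|[|//]]]]] ?].
- move=> z; move: xy; case: x => [[|[|[|[|[|//]]]]] ?];
  case: y => [[|[|[|[|[|//]]]]] ?] //; by case: z => [[|[|[|[|[|//]]]]] ?].
- move=> z; move: xy; case: x => [[|[|[|[|[|//]]]]] ?];
  case: y => [[|[|[|[|[|//]]]]] ?] //; by case: z => [[|[|[|[|[|//]]]]] ?].
apply: gdist_le (@has_walk_size _ _ _
  [:: I5 (3 * x + 3 * y)%N; I5 (2 * y + 4 * x)%N] _).
by move: xy; case: x => [[|[|[|[|[|//]]]]] ?]; case: y => [[|[|[|[|[|//]]]]] ?].
Qed.

Lemma pentagon_homology1 (R : realType) :
  exists h : GLMY_homology R pentagon 1, h <> 0.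
Proof.
pose c : chain R 'I_5 1 := \sum_i elem R [tuple i; ordS i].
apply: (homology1_neq0 (@winding_diag R) (c := c) (@winding_add R)).
  rewrite mem_cycles1; apply/andP; split.
    by apply: rpred_sum => i _; apply: elem_allowed; rewrite /= /pentagon eqxx.
  rewrite linear_sum; under eq_bigr => i _ do rewrite /= boundary_elem1.
  rewrite sumrB subr_eq0; apply/eqP.
  by rewrite [RHS](reindex_inj (@ordS_inj 5)).
rewrite linear_sum (eq_bigr (fun=> 1)) => [|i _].
  by rewrite sumr_const card_ord pnatr_eq0.
rewrite /= dot_form_chain; last exact: winding_diag.
have -> : winding R i (ordS i) = 3 - 2.
  by case: i => [[|[|[|[|[|//]]]]] ?].
by ring.
Qed.

End Pentagon.

Theorem theorem1p1 (R : realType) :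
  (forall (T : finType) (e : rel T),
     symmetric e -> irreflexive e -> (exists x y, e x y) ->
     1 / 2 < kappa_min R e ->
     forall h : GLMY_homology R e 1, h = 0)
  /\
  (forall (T : finType) (e : rel T),
     symmetric e -> irreflexive e -> (exists x y, e x y) ->
     (exists h : GLMY_homology R e 1, h <> 0) ->
     exists x y, e x y /\ kappa_LLY R e x y <= 1 / 2)
  /\
  (forall c : R, c < 1 / 2 ->
     ~ (forall (T : finType) (e : rel T),
          symmetric e -> irreflexive e -> (exists x y, e x y) ->
          c < kappa_min R e ->
          forall h : GLMY_homology R e 1, h = 0)).
Proof.
split=> [T e sym_e irr_e _ curv|]; last split=> [T e sym_e irr_e _ [h hN0]|c c_lt].
- apply: homology1_eq0 => // x y xy.
  exact: lt_le_trans curv (kappa_min_le R xy).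
- apply: contrapT => curv; apply: hN0; apply: homology1_eq0 => // x y xy.
  by rewrite ltNge; apply/negP => le_xy; apply: curv; exists x, y.
- move=> vanish; have [h hN0] := pentagon_homology1 R.
  have edge : exists x y, pentagon x y by exists ord0, (ordS ord0); rewrite /pentagon eqxx.
  apply/hN0/vanish => //; [exact: pentagon_sym|exact: pentagon_irr|].
  apply: kappa_min_gt => // x y /(pentagon_kappa_LLY R).
  exact: lt_le_trans.
Qed.
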